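(* Every graph with a $\{C_n : n=3,5,\dots\}$-factor is a Sterboul--Deming graph.
   Context: All graphs are finite, undirected and simple. A $2$-factor of $G$ is a spanning subgraph in which every vertex has degree $2$. A $\{C_n:n=3,5,\dots\}$-factor of $G$ is a $2$-factor of $G$ each of whose cycles is odd. Let $M$ be a matching of a graph $G$. A path (or walk) is $M$-alternating if, of any two consecutive edges, exactly one belongs to $M$; an $mm$-$M$-path is an $M$-alternating path whose first and last edges are in $M$. An $M$-blossom is an odd cycle of length $2k+1$ with exactly $k$ edges in $M$; its base is the unique vertex of the cycle not covered by those $k$ edges. An $M$-Tflower consists of an $M$-blossom together with an $M$-stem, i.e. an $M$-alternating path of even length (possibly zero) connecting the base of the blossom to a vertex not saturated by $M$ in $G$, where the base is the only common vertex of the blossom and the stem. An $M$-Tposy consists of two $M$-blossoms joined by an $mm$-$M$-path whose endpoints are the bases of the two blossoms, such that no internal vertex of the path lies in the blossoms and the intersection of the two blossoms is either empty or an $mm$-$M$-path. Define $SD(G)$ as the set of vertices $v$ of $G$ for which there is a maximum matching $M$ of $G$ such that $v$ lies in an $M$-Tflower or an $M$-Tposy, and $KE(G)=V(G)\setminus SD(G)$. A graph $G$ is a Sterboul--Deming graph if $KE(G)=\emptyset$. *)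

(* Defs.v *)
From mathcomp Require Import all_boot.
From mathcomp Require Import boolp.
Set Implicit Arguments.
Unset Strict Implicit.
Unset Printing Implicit Defensive.

(** A simple graph on the vertex set [T : finType] is a symmetric
    irreflexive relation [e : rel T]; edges are 2-element vertex sets. *)

Definition edge_set (T : finType) (e : rel T) : {set {set T}} :=
  [set [set x; y] | x in T, y in T & e x y].

(** The adjacency relation of the spanning subgraph with edge set [F]. *)
Definition edge_rel (T : finType) (F : {set {set T}}) : rel T :=
  fun x y => [set x; y] \in F.

(** The path with vertices [x :: p]; its length is [size p]. *)
Definition graph_path (T : finType) (e : rel T) (x : T) (p : seq T) : bool :=
  path e x p && uniq (x :: p).

Definition walk_edges (T : finType) (x : T) (p : seq T) : seq {set T} :=
  pairmap (fun a b => [set a; b]) x p.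

Definition internal_vertices (T : finType) (x : T) (p : seq T) : seq T :=
  behead (belast x p).

(** [ucycleb] alone would accept sequences of length less than 3. *)
Definition graph_cycle (T : finType) (e : rel T) (c : seq T) : bool :=
  (2 < size c) && ucycleb e c.

Definition cycle_edges (T : finType) (c : seq T) : seq {set T} :=
  [seq [set x; next c x] | x <- c].

Definition two_factor (T : finType) (e : rel T) (F : {set {set T}}) : Prop :=
  F \subset edge_set e /\ forall x : T, #|[set A in F | x \in A]| = 2.

Definition odd_cycle_factor (T : finType) (e : rel T) (F : {set {set T}}) :
    Prop :=
  two_factor e F /\
  forall c : seq T, graph_cycle (edge_rel F) c -> odd (size c).

Definition matching (T : finType) (e : rel T) (M : {set {set T}}) : bool :=
  (M \subset edge_set e) && trivIset M.

Definition maximum_matching (T : finType) (e : rel T) (M : {set {set T}}) :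
    Prop :=
  matching e M /\ forall M' : {set {set T}}, matching e M' -> #|M'| <= #|M|.

Definition saturated (T : finType) (M : {set {set T}}) (x : T) : bool :=
  x \in cover M.

Definition alternating (T : finType) (M : {set {set T}}) (x : T) (p : seq T) :
    bool :=
  sorted (fun A B => (A \in M) (+) (B \in M)) (walk_edges x p).

(** The default [set0] is never reached, since the edge list is nonempty. *)
Definition mm_path (T : finType) (e : rel T) (M : {set {set T}})
    (x : T) (p : seq T) : bool :=
  [&& graph_path e x p, alternating M x p, p != [::],
      head set0 (walk_edges x p) \in M & last set0 (walk_edges x p) \in M].

Definition blossom (T : finType) (e : rel T) (M : {set {set T}}) (c : seq T) :
    Prop :=
  graph_cycle e c /\
  exists k : nat, size c = k.*2.+1 /\ count (mem M) (cycle_edges c) = k.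

Definition blossom_base (T : finType) (M : {set {set T}}) (c : seq T) (b : T) :
    Prop :=
  b \in c /\ forall A, A \in cycle_edges c -> A \in M -> b \notin A.

(** The stem is the path [b :: p]. *)
Definition Tflower (T : finType) (e : rel T) (M : {set {set T}})
    (c : seq T) (b : T) (p : seq T) : Prop :=
  [/\ blossom e M c /\ blossom_base M c b,
      graph_path e b p /\ alternating M b p,
      ~~ odd (size p),
      ~~ saturated M (last b p) &
      forall x, x \in c -> x \in b :: p -> x = b].

(** The intersection of two blossoms is taken as an intersection of
    subgraphs: both the vertices and the edges are compared with those of the
    path. *)
Definition blossom_meet_mm_path (T : finType) (e : rel T) (M : {set {set T}})
    (c1 c2 : seq T) : Prop :=
  exists (y : T) (q : seq T),
    [/\ mm_path e M y q,
        forall z, (z \in y :: q) = (z \in c1) && (z \in c2) &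
        forall A, (A \in walk_edges y q) =
                  (A \in cycle_edges c1) && (A \in cycle_edges c2)].

(** The blossoms are [c1] and [c2], joined by the path [b :: p]. *)
Definition Tposy (T : finType) (e : rel T) (M : {set {set T}})
    (c1 c2 : seq T) (b : T) (p : seq T) : Prop :=
  [/\ blossom e M c1 /\ blossom_base M c1 b,
      blossom e M c2 /\ blossom_base M c2 (last b p),
      mm_path e M b p,
      forall x, x \in internal_vertices b p -> x \notin c1 /\ x \notin c2 &
      (forall x, x \in c1 -> x \notin c2) \/ blossom_meet_mm_path e M c1 c2].

Definition in_Tflower (T : finType) (e : rel T) (M : {set {set T}}) (v : T) :
    Prop :=
  exists (c : seq T) (b : T) (p : seq T),
    Tflower e M c b p /\ (v \in c \/ v \in b :: p).

Definition in_Tposy (T : finType) (e : rel T) (M : {set {set T}}) (v : T) :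
    Prop :=
  exists (c1 c2 : seq T) (b : T) (p : seq T),
    Tposy e M c1 c2 b p /\ [\/ v \in c1, v \in c2 | v \in b :: p].

Definition SD (T : finType) (e : rel T) : {set T} :=
  [set v | `[< exists M : {set {set T}},
                 maximum_matching e M /\
                 (in_Tflower e M v \/ in_Tposy e M v) >]].

Definition KE (T : finType) (e : rel T) : {set T} := ~: SD e.

Definition Sterboul_Deming (T : finType) (e : rel T) : Prop := KE e = set0.

(* Main.v *)
(** Among the maximum matchings, take [M] meeting the odd cycle factor [F] in as
    many edges as possible. Then no [M]-alternating cycle has all its edges
    outside [M] in [F]: exchanging along it would increase the intersection
    with [F], unless the cycle lies in [F], but the cycles of [F] are odd.
    Every vertex is on an edge of [F] outside [M]. So a walk using alternately
    such edges and edges of [M] can be continued until it reaches an unsaturated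
    vertex or first meets itself, and in the latter case it forms a blossom.
    If [v] is unsaturated, the walk from [v] gives a flower. Otherwise, let [v']
    be the partner of [v] and walk from both [v] and [v']. If the two arms are
    disjoint, they form with the edge [v v'] a flower or a posy, since there is
    no augmenting path. If the second arm hits the first one at [w], the
    absence of alternating cycles forces the cycle through [v v'] and [w] to be
    a blossom with base [w], and forces [w] to precede the blossom of the first
    arm, if any; the rest of the first arm completes a flower or a posy. *)
Require Import Defs.
From mathcomp Require Import all_boot boolp zify.
Set Implicit Arguments.
Unset Strict Implicit.
Unset Printing Implicit Defensive.

(** The vertex lists of paths and blossoms below are rearranged pieces of one duplicate-free list.
    Comparing multiplicities reduces their uniqueness to linear arithmetic. *)
Lemma subcount_uniq (T : eqType) (s1 s2 : seq T) :
  uniq s1 -> (forall x, count_mem x s2 <= count_mem x s1) -> uniq s2.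
Proof.
move=> u1 le21; have {}le21 x : count_mem x s2 <= 1.
  by apply: leq_trans (le21 x) _; rewrite count_uniq_mem //; case: (x \in s1).
elim: s2 le21 => //= y s IHs le1; rewrite -has_pred1 has_count.
have := le1 y; rewrite eqxx => le1y; apply/andP; split; first by lia.
by apply: IHs => x; have := le1 x; case: (y == x) => /=; lia.
Qed.

(** * Matchings and the exchange of edges *)

Section Matching.
Variable T : finType.
Implicit Types (x y z : T) (p q s t : seq T) (A B : {set T}) (M : {set {set T}}).

Lemma trivIset_eqP M :
  reflect (forall A B x, A \in M -> B \in M -> x \in A -> x \in B -> A = B)
          (trivIset M).
Proof.
apply: (iffP trivIsetP) => [tI A B x MA MB Ax Bx | tI A B MA MB neqAB].
  case: (eqVneq A B) => // /(tI A B MA MB)/pred0P/(_ x).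
  by rewrite /= Ax Bx.
apply/pred0P => x /=; apply/negP => /andP[Ax Bx].
by rewrite (tI A B x) ?eqxx in neqAB.
Qed.

(** These are the edges at positions 0, 2, 4, ... of the walk through [s], that is, one of the two
    classes of an alternating walk; a last unpaired vertex is dropped. *)
Fixpoint pairs s : seq {set T} :=
  if s is x :: s' then
    if s' is y :: s'' then [set x; y] :: pairs s'' else [::]
  else [::].

Lemma size_pairs s : size (pairs s) = (size s)./2.
Proof. by move: s; fix IH 1 => -[|x [|y s]] //=; rewrite IH. Qed.

Lemma pairs_mem s A x : A \in pairs s -> x \in A -> x \in s.
Proof.
move: s; fix IH 1 => -[|a [|b s]] //=; rewrite !inE.
case/predU1P => [-> | /IH sA /sA ->]; last by rewrite !orbT.
by rewrite !inE => /orP[] ->; rewrite ?orbT.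
Qed.

Lemma pairs_cover s x :
  ~~ odd (size s) -> x \in s -> exists2 A, A \in pairs s & x \in A.
Proof.
move: s; fix IH 1 => -[|a [|b s]] //=; rewrite negbK => ev_s.
rewrite !inE orbA => /orP[xab|/IH[]// A sA Ax].
  by exists [set a; b]; rewrite ?inE ?eqxx.
by exists A => //; rewrite inE sA orbT.
Qed.

Lemma pairs_disjoint s A B x :
  uniq s -> A \in pairs s -> B \in pairs s -> x \in A -> x \in B -> A = B.
Proof.
move: s A B x; fix IH 1 => -[|a [|b s]] //= A B x /and3P[].
rewrite !inE negb_or => /andP[_ as'] bs us.
have sub C : C \in pairs s -> x \in C -> x \notin [set a; b].
  move=> sC /(pairs_mem sC) sx; rewrite !inE negb_or.
  by apply/andP; split; apply: contraTneq sx => ->.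
case/predU1P => [-> | sA] /predU1P[-> // | sB] Ax Bx.
- by case/negP: (sub B sB Bx).
- by case/negP: (sub A sA Ax).
- exact: (IH s) sA sB Ax Bx.
Qed.

Lemma pairs_uniq s : uniq s -> uniq (pairs s).
Proof.
move: s; fix IH 1 => -[|a [|b s]] //= /and3P[as' bs us].
rewrite IH // andbT; apply/negP => /(@pairs_mem _ _ a).
by rewrite !inE eqxx => /(_ isT) sa; rewrite inE sa orbT in as'.
Qed.

Lemma card_pairs s : uniq s -> #|[set:: pairs s]| = (size s)./2.
Proof. by move=> us; rewrite cardsE (card_uniqP (pairs_uniq us)) size_pairs. Qed.

(** A kept edge of [M] cannot meet [t]: a common vertex is saturated, so it lies in [s] and is
    already covered there by an edge of [M] in [pairs s]. This serves for augmenting paths as well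
    as for alternating cycles. *)
Lemma exchange (e : rel T) M s t :
    matching e M -> uniq s -> uniq t -> ~~ odd (size s) -> ~~ odd (size t) ->
    {subset pairs s <= M} -> {subset pairs t <= edge_set e} ->
    {in t, forall x, x \in s \/ ~~ saturated M x} ->
  let M' := (M :\: [set:: pairs s]) :|: [set:: pairs t] in
  [/\ matching e M', [disjoint M :\: [set:: pairs s] & [set:: pairs t]] &
      #|M'| + (size s)./2 = #|M| + (size t)./2].
Proof.
case/andP=> sMe /trivIset_eqP tI us ut evs evt sM te ts M'.
have sepx A B x : A \in M :\: [set:: pairs s] -> B \in pairs t ->
    x \in A -> x \in B -> False.
  rewrite !inE => /andP[As MA] tB Ax /(pairs_mem tB) tx.
  case: (ts _ tx) => [sx | /negP[]]; last by apply/bigcupP; exists A.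
  have [C sC Cx] := pairs_cover evs sx.
  by rewrite (tI A C x) ?sC // in As; apply: sM.
have dis : [disjoint M :\: [set:: pairs s] & [set:: pairs t]].
  apply/pred0P => A /=; apply/negP => /andP[MA]; rewrite inE => tA.
  have := te _ tA; case/imset2P=> x y _ _ defA.
  by apply: (sepx A A x); rewrite // defA !inE eqxx.
split=> //.
  apply/andP; split.
    apply/subsetP => A; rewrite !inE => /orP[/andP[_ MA] | /te//].
    exact: (subsetP sMe).
  apply/trivIset_eqP => A B x.
  rewrite /M' !in_setU ![_ \in [set:: pairs t]]inE.
  case/orP=> MA /orP[] MB Ax Bx.
  - by move: MA MB; rewrite !inE => /andP[_ MA] /andP[_ MB]; apply: (tI _ _ x).
  - by case: (sepx A B x).
  - by case: (sepx B A x).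
  - exact: (pairs_disjoint ut) MA MB Ax Bx.
have := leq_card_setU (M :\: [set:: pairs s]) [set:: pairs t].
rewrite dis => -[_ /eqP ->]; rewrite card_pairs // addnAC.
rewrite -(cardsID [set:: pairs s] M) (setIidPr _) ?card_pairs //.
  by set d := #|_|; lia.
by apply/subsetP => A; rewrite inE => /sM.
Qed.

End Matching.

(** * Walks alternating between two edge sets *)

Section AlternatingWalk.
Variable T : finType.
Implicit Types (x y z : T) (p q s t : seq T) (b : bool).
Implicit Types (A : {set T}) (M N : {set {set T}}).

Lemma edge_rel_sym M : symmetric (edge_rel M).
Proof. by move=> x y; rewrite /edge_rel setUC. Qed.

Lemma in_edge_set (e : rel T) x y :
  symmetric e -> [set x; y] \in edge_set e -> e x y.
Proof.
move=> e_sym /imset2P[a a' _]; rewrite inE => /andP[_ eaa'] /setP eq_xy.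
have:= eq_xy a; have:= eq_xy a'; have:= eq_xy x; have:= eq_xy y.
rewrite !inE !eqxx !orbT /= => /esym/orP[]/eqP-> /esym/orP[]/eqP->.
all: by do 2![case/orP=> /eqP ?]; subst; rewrite // e_sym.
Qed.

(** The flag [b] tells whether the next edge is taken from [M] or from [N]. The set [N] will be the
    part of the factor outside [M]. *)
Fixpoint altwalk M N b x p : bool :=
  if p is y :: p' then
    edge_rel (if b then M else N) x y && altwalk M N (~~ b) y p'
  else true.

Lemma altwalk_cat M N b x p q :
  altwalk M N b x (p ++ q) =
  altwalk M N b x p && altwalk M N (b (+) odd (size p)) (last x p) q.
Proof.
elim: p b x => [|y p IHp] b x /=; first by rewrite addbF.
by rewrite IHp andbA addNb addbN.
Qed.

Lemma altwalk_rev M N b x p y :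
  altwalk M N b x (rcons p y) ->
  altwalk M N (b (+) odd (size p)) y (rcons (rev p) x).
Proof.
elim: p b x => [|z p IHp] b x /=.
  by rewrite !andbT addbF edge_rel_sym.
case/andP=> xz /IHp; rewrite rev_cons -!cats1 !altwalk_cat /=.
rewrite !size_cat size_rev addn1 /= cats1 last_rcons andbT.
rewrite addNb -addbN => /andP[-> ->] /=; rewrite edge_rel_sym.
by rewrite andbT addbK.
Qed.

Lemma altwalk_path (e : rel T) M N b x p :
    symmetric e -> M \subset edge_set e -> N \subset edge_set e ->
  altwalk M N b x p -> path e x p.
Proof.
move=> e_sym sMe sNe; elim: p b x => //= y p IHp b x /andP[xy /IHp->].
rewrite andbT; apply: in_edge_set => //.
by case: b xy; apply: subsetP.
Qed.

Lemma altwalk_alternating M N b x p :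
  [disjoint M & N] -> altwalk M N b x p -> alternating M x p.
Proof.
move=> dMN; have inM b' A : A \in (if b' then M else N) -> (A \in M) = b'.
  by case: b' => // NA; apply: (disjointFl dMN).
rewrite /alternating; case: p => //= y p /andP[/inM].
elim: p b x y => //= z p IHp b x y xyM /andP[/inM yzM ap].
by rewrite xyM yzM addbN addbb; apply: (IHp (~~ b)).
Qed.

Lemma count_altwalk M N b x p :
    [disjoint M & N] -> altwalk M N b x p ->
  count (mem M) (walk_edges x p) = (size p + b)./2.
Proof.
move=> dMN; elim: p b x => [|y p IHp] b x /=; first by case: b.
case/andP=> xy /IHp; rewrite /walk_edges => ->.
rewrite /edge_rel in xy *; case: b xy => [->|/(disjointFl dMN)->] /=.
  by rewrite addn0 addn1.
by rewrite addn0 addn1.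
Qed.

Lemma cycle_edgesE x p :
  uniq (x :: p) -> cycle_edges (x :: p) = walk_edges x (rcons p x).
Proof.
move=> u; apply: (@eq_from_nth _ set0).
  by rewrite size_map size_pairmap size_rcons.
move=> i; rewrite size_map => lti; rewrite (nth_map x) //.
rewrite (nth_pairmap x) ?size_rcons // next_nth mem_nth // index_uniq //.
rewrite -rcons_cons nth_rcons lti nth_rcons.
(* At the last index [nth] runs past the end of [p] and returns its default [x], which is the vertex
   closing the cycle. *)
move: lti; rewrite /= ltnS leq_eqVlt => /predU1P[-> | ->] //.
by rewrite ltnn eqxx [nth x p _]nth_default.
Qed.

Lemma walk_edges_sub x p A z : A \in walk_edges x p -> z \in A -> z \in x :: p.
Proof.
elim: p x => //= y p IHp x; rewrite inE => /predU1P[-> | pA /(IHp _ pA)].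
  by rewrite !inE orbA => ->.
by rewrite !inE => ->; rewrite orbT.
Qed.

Lemma head_walk_edges M N x p :
  altwalk M N true x p -> p != [::] -> head set0 (walk_edges x p) \in M.
Proof. by case: p => //= y p /andP[]. Qed.

Lemma last_walk_edges M N x p :
    altwalk M N true x p -> odd (size p) ->
  last set0 (walk_edges x p) \in M.
Proof.
case/lastP: p => //= p y; rewrite size_rcons /= -cats1 altwalk_cat => /andP[_].
rewrite /walk_edges pairmap_cat last_cat /= => + /negbTE ep.
by rewrite ep /= => /andP[].
Qed.

End AlternatingWalk.

(** * Building flowers and posies from alternating walks *)

Section Flowers.
Variables (T : finType) (e : rel T) (M N : {set {set T}}).
Implicit Types (x y z v w : T) (p q s t c : seq T) (b : bool).
Hypotheses (e_sym : symmetric e) (e_irr : irreflexive e).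
Hypotheses (mM : matching e M) (sNe : N \subset edge_set e).
Hypothesis dMN : [disjoint M & N].

Let sMe : M \subset edge_set e. Proof. by case/andP: mM. Qed.
Notation altp := (altwalk M N).

(** The blossom is read from its base [z]: the cycle leaves [z] and returns to it by edges of
    [N]. *)
Definition alt_blossom z t :=
  [/\ uniq (z :: t), ~~ odd (size t), altp false z t & edge_rel N (last z t) z].

Lemma alt_blossomP z t :
  alt_blossom z t -> blossom e M (z :: t) /\ blossom_base M (z :: t) z.
Proof.
case=> u ev at_ cl.
have at1 : altp false z (rcons t z).
  by rewrite -cats1 altwalk_cat at_ (negbTE ev) /= cl.
(* As [size t] is even, only the loop at [z] has to be excluded. *)
have t_gt1 : 1 < size t.
  case: t u ev {at_ at1} cl => [|y [|x t]] //= _ _.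
  by move/(subsetP sNe)/(in_edge_set e_sym); rewrite e_irr.
split; [split|split].
- rewrite /graph_cycle /= ltnS t_gt1; apply/andP; split=> //.
  by rewrite /ucycleb u andbT; exact: (altwalk_path e_sym sMe sNe at1).
- exists (size t)./2; split; first by rewrite /= even_halfK.
  rewrite (cycle_edgesE u) (count_altwalk dMN at1) size_rcons addn0.
  by rewrite -uphalfE uphalf_half (negbTE ev).
- by rewrite inE eqxx.
move=> A; rewrite (cycle_edgesE u).
case: t u {ev} at_ {at1} cl t_gt1 => // a t u; rewrite /= => /andP[za _].
case/lastP: t u => // t y u; rewrite last_rcons => yz _.
rewrite /walk_edges /= !inE -[rcons _ z]cats1 pairmap_cat last_rcons mem_cat /=.
rewrite inE => /or3P[/eqP-> | At | /eqP->] MA.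
- by rewrite /edge_rel (disjointFr dMN MA) in za.
- by apply/negP => /(walk_edges_sub At) zt; rewrite /= zt in u.
- by rewrite /edge_rel (disjointFr dMN MA) in yz.
Qed.

Lemma Tflower_intro z t q :
    alt_blossom z t -> altp true z q -> ~~ odd (size q) ->
    uniq (z :: t ++ q) -> ~~ saturated M (last z q) ->
  Tflower e M (z :: t) z q.
Proof.
move=> bl aq eq u nsat; split=> //; first exact: alt_blossomP.
- split; last exact: (altwalk_alternating dMN aq).
  rewrite /graph_path (altwalk_path e_sym sMe sNe aq) //.
  apply: subcount_uniq u _ => x /=; rewrite count_cat; clear; lia.
move=> x; rewrite !inE => /orP[/eqP-> // | tx] /orP[/eqP-> // | qx].
move: u; rewrite /= cat_uniq => /and4P[_ _ /hasP[]].
by exists x.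
Qed.

(** Uniqueness of the list of all vertices gives at once a simple joining path, disjoint blossoms,
    and internal vertices outside both blossoms. *)
Lemma Tposy_intro z t q z' t' :
    alt_blossom z t -> alt_blossom z' t' -> altp true z (rcons q z') ->
    ~~ odd (size q) -> uniq (z :: t ++ q ++ z' :: t') ->
  Tposy e M (z :: t) (z' :: t') z (rcons q z').
Proof.
move=> bl bl' aq oq u.
have dis : uniq ((z :: t) ++ (z' :: t') ++ q).
  apply: subcount_uniq u _ => x /=.
  by rewrite !count_cat /= !count_cat; clear; lia.
move: dis; rewrite !cat_uniq => /and3P[_ /hasPn dis1 /and3P[_ /hasPn dis2 _]].
split.
- exact: alt_blossomP.
- by rewrite last_rcons; apply: alt_blossomP.
- apply/and5P; split.
  + rewrite /graph_path (altwalk_path e_sym sMe sNe aq) //.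
    apply: subcount_uniq u _ => x /=.
    by rewrite -cats1 !count_cat /=; clear; lia.
  + exact: (altwalk_alternating dMN aq).
  + by case: (q).
  + by apply: head_walk_edges aq _; case: (q).
  + by apply: last_walk_edges aq _; rewrite size_rcons.
- rewrite /internal_vertices belast_rcons /= => x qx; split.
    by apply: dis1; rewrite mem_cat qx orbT.
  exact: dis2.
- by left=> x; apply: contraL => zx'; apply: dis1; rewrite mem_cat zx'.
Qed.

End Flowers.

(** * Greedy alternating walks and the case analysis on two arms *)

Section Greedy.
Variables (T : finType) (e : rel T) (M N : {set {set T}}).
Implicit Types (x y z u v w : T) (p q r s t S : seq T) (b : bool).
Hypotheses (e_sym : symmetric e) (e_irr : irreflexive e).
Hypotheses (mM : matching e M) (sNe : N \subset edge_set e).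
Hypothesis dMN : [disjoint M & N].
Notation altp := (altwalk M N).
Hypothesis no_alt_cycle : forall x p, uniq (x :: p) -> odd (size p) ->
  altp true x p -> ~~ edge_rel N (last x p) x.
Hypothesis no_augmenting : forall x p, uniq (x :: p) -> odd (size p) ->
  altp false x p -> ~~ saturated M x -> saturated M (last x p).
Hypothesis N_total : forall x, exists y, edge_rel N x y.

Lemma matching_inj x y z : edge_rel M x y -> edge_rel M x z -> y = z.
Proof.
case/andP: mM => sMe /trivIset_eqP tI Mxy Mxz.
have exy : e x y by apply: in_edge_set (subsetP sMe _ Mxy).
have /setP/(_ y) : [set x; y] = [set x; z].
  by apply: (tI _ _ x); rewrite ?inE ?eqxx.
rewrite !inE eqxx orbT => /esym/orP[]/eqP // yx.
by rewrite yx e_irr in exy.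
Qed.

Lemma saturated_edge x y : edge_rel M x y -> saturated M x.
Proof. by move=> Mxy; apply/bigcupP; exists [set x; y]; rewrite ?inE ?eqxx. Qed.

Lemma saturatedP x : saturated M x -> exists y, edge_rel M x y.
Proof.
case/bigcupP=> A MA; case/andP: mM => /subsetP/(_ A MA)/imset2P[a a' _ _ defA] _.
move: MA; rewrite {}defA !inE /edge_rel => MA /orP[]/eqP->; first by exists a'.
by exists a; rewrite setUC.
Qed.

(** Each vertex of [p] is entered or left by an edge of [M], except the last one when the length is
    odd; that one is then unsaturated. *)
Lemma altwalk_partner v p z w :
    altp false v p -> ~~ odd (size p) || ~~ saturated M (last v p) ->
  z \in p -> edge_rel M z w -> w \in p.
Proof.
move=> ap end_p /splitPr def_p; case: def_p ap end_p => p1 p2.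
rewrite altwalk_cat /= last_cat size_cat /= => /and3P[_ Mz ap2] end_p Mzw.
rewrite mem_cat; case: (boolP (odd (size p1))) Mz ap2 end_p => /= op1 Mz.
  move=> _ _; suff -> : w = last v p1.
    by case: p1 op1 Mz => //= y p1 _ _; rewrite mem_last.
  by rewrite edge_rel_sym in Mz; apply: matching_inj Mzw Mz.
case: p2 => [_|y p2 /andP[/(matching_inj Mzw)->]]; last first.
  by rewrite !inE eqxx !orbT.
by rewrite addn1 /= op1 /= (saturated_edge Mzw).
Qed.

(** [S] is the set of vertices to avoid: empty for the first arm, the whole first arm for the
    second. *)
Variant greedy_spec S v : Prop :=
  | GreedyBlossom p s z t of
      uniq (v :: p) & altp false v p & v :: p = s ++ z :: t
      & ~~ odd (size s) & alt_blossom M N z t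
      & {in v :: p, forall x, x \notin S}
  | GreedyUnsaturated p of
      uniq (v :: p) & altp false v p & odd (size p)
      & ~~ saturated M (last v p) & {in v :: p, forall x, x \notin S}
  | GreedyHit p w of
      uniq (v :: p) & altp false v p & ~~ odd (size p)
      & edge_rel N (last v p) w & w \in S & {in v :: p, forall x, x \notin S}.

(* The walk returning to a vertex at odd distance from [v] would close an
   alternating cycle, so when it first meets itself it forms a blossom. *)
Lemma greedy S v :
    (forall z w, z \in S -> edge_rel M z w -> w != v -> w \in S) ->
    v \notin S ->
  greedy_spec S v.
Proof.
move=> closedS vS.
suff: forall n p, #|T| < size p + n -> uniq (v :: p) -> altp false v p ->
    ~~ odd (size p) -> {in v :: p, forall x, x \notin S} -> greedy_spec S v.
  move/(_ #|T|.+1 [::]); apply=> //= x; by rewrite inE => /eqP->.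
elim=> [|n IHn] p lt_p up ap ep pS.
  have := leq_ltn_trans (max_card (mem (v :: p))) lt_p.
  by rewrite (card_uniqP up) addn0 ltnNge leqnSn.
have [z Nz] := N_total (last v p).
have [zS | zS] := boolP (z \in S); first exact: (@GreedyHit _ _ p z).
have [zp | zp] := boolP (z \in v :: p).
  have [s [t def_p]] : exists s t, v :: p = s ++ z :: t.
    by case/splitPr: zp => s t; exists s, t.
  have ost : odd (size t) = odd (size s).
    move/(congr1 (odd \o size)): def_p; rewrite /= size_cat oddD /= ep.
    by case: odd; case: odd.
  have lst : last v p = last z t.
    by rewrite -[last v p]/(last v (v :: p)) def_p last_cat.
  have altz : altp (odd (size s)) z t.
    case: s def_p {ost} => [|y s] [vy defp]; first by rewrite -vy -defp.
    by move: ap; rewrite defp altwalk_cat /= => /and3P[].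
  have [os | es] := boolP (odd (size s)).
    have uzt: uniq (z :: t).
      by move: up; rewrite def_p cat_uniq => /and3P[].
    suff /negP[]: ~~ edge_rel N (last z t) z by rewrite -lst.
    by apply: no_alt_cycle => //; [rewrite ost | rewrite os in altz].
  apply: (@GreedyBlossom _ _ p s z t) => //.
  split; rewrite -?lst //; last by rewrite (negbTE es) in altz.
    by move: up; rewrite def_p cat_uniq => /and3P[].
  by rewrite ost.
have upz : uniq (v :: rcons p z).
  by rewrite -rcons_cons rcons_uniq zp.
have apz : altp false v (rcons p z).
  by rewrite -cats1 altwalk_cat ap (negbTE ep) /= Nz.
have pzS : {in v :: rcons p z, forall x, x \notin S}.
  by move=> x; rewrite -rcons_cons mem_rcons inE => /predU1P[-> // | /pS].
have [/saturatedP[w Mzw] | zM] := boolP (saturated M z); last first.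
  apply: (@GreedyUnsaturated _ _ (rcons p z)) => //.
    by rewrite size_rcons.
  by rewrite last_rcons.
(* Otherwise the edge [z v] of [M], the walk, and the edge of [N] back to [z] form an alternating
   cycle. *)
have wv : w != v.
  apply: contraTneq Nz => wv; apply: (@no_alt_cycle z (v :: p)) => //.
  - by rewrite cons_uniq zp.
  - by rewrite /= -wv Mzw wv ap.
have wp : w \notin p.
  apply: contra zp => wp; rewrite inE; apply/orP; right.
  by apply: (altwalk_partner ap _ wp (w := z)); rewrite ?ep // edge_rel_sym.
have wz : w != z.
  apply: contraTneq Mzw => ->; apply/negP => /(subsetP (proj1 (andP mM))).
  by move/(in_edge_set e_sym); rewrite e_irr.
apply: (IHn (rcons (rcons p z) w)).
- by move: lt_p; rewrite !size_rcons addnS !addSn => /leqW.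
- rewrite -rcons_cons rcons_uniq upz andbT.
  by rewrite inE mem_rcons inE !negb_or wv wz.
- by rewrite -cats1 altwalk_cat apz size_rcons last_rcons /= ep Mzw.
- by rewrite !size_rcons /= negbK.
move=> x; rewrite -rcons_cons mem_rcons inE => /predU1P[-> | /pzS //].
apply: contra zS => wS; apply: (closedS w) => //; first by rewrite edge_rel_sym.
by apply: contraNneq zp => ->; rewrite inE eqxx.
Qed.

(** From [z] the walk goes back along the arm to [v], crosses the matching edge [v u] and follows
    the other arm. *)
Lemma altwalk_join u v p s z t q :
    edge_rel M u v -> altp false v p -> v :: p = s ++ z :: t ->
    altp false u q ->
  altp (~~ odd (size s)) z (rev s ++ u :: q).
Proof.
move=> Muv ap def_p aq.
have : altp true u (rcons s z ++ t) by rewrite cat_rcons -def_p /= Muv.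
rewrite altwalk_cat => /andP[/altwalk_rev ar _].
rewrite -cat_rcons altwalk_cat ar size_rcons last_rcons size_rev /=.
by rewrite addbN addNb negbK addbb.
Qed.

Lemma cat_uniqI p q :
  uniq p -> uniq q -> {in q, forall x, x \notin p} -> uniq (p ++ q).
Proof. by move=> up uq qp; rewrite cat_uniq up uq andbT; apply/hasPn. Qed.

Lemma eq_cat_cons x y s t p q :
    s ++ x :: t = p ++ y :: q -> size s < size p ->
  exists2 r, p = s ++ x :: r & t = r ++ y :: q.
Proof.
elim: s p => [|a s IHs] [|b p] //= [-> eq_spq]; first by exists p.
by move/(IHs _ eq_spq)=> [r -> ->]; exists r.
Qed.

(** A blossom ending the walk from [v] has the reversed initial segment as stem; an unsaturated end
    would make the walk augmenting. *)
Lemma flower_or_posy_unsaturated v :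
  ~~ saturated M v -> in_Tflower e M v \/ in_Tposy e M v.
Proof.
move=> vM; case: (@greedy [::] v) => // [p s z t up ap def_p es bl _ | p up ap op].
  left; exists (z :: t), z, (rev s).
  have lst : last z (rev s) = v.
    by case: s def_p {es} => [|x s] [-> //]; rewrite rev_cons last_rcons.
  split; last by right; rewrite -lst mem_last.
  apply: (Tflower_intro e_sym e_irr mM sNe dMN) => //; rewrite ?size_rev ?lst //.
    case: s def_p es {lst} => //= x s [<- def_p]; rewrite negbK => os.
    move: ap; rewrite def_p -cat_rcons altwalk_cat => /andP[/altwalk_rev].
    by rewrite os rev_cons.
  apply: subcount_uniq up _ => x.
  by rewrite def_p /= ?count_cat /= ?count_rev; clear; lia.
by rewrite (no_augmenting up op ap).
Qed.

(** This supplies the premises of [greedy] for the second arm, which starts at [v'] and avoids the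
    first. *)
Lemma altwalk_closed v v' p :
    edge_rel M v v' -> uniq (v :: p) -> altp false v p ->
    ~~ odd (size p) || ~~ saturated M (last v p) ->
  v' \notin v :: p /\
  forall z w, z \in v :: p -> edge_rel M z w -> w != v' -> w \in v :: p.
Proof.
move=> Mvv' /andP[vp _] ap end_p; split.
  rewrite inE negb_or; apply/andP; split.
    apply: contraTneq Mvv' => ->; apply/negP => /(subsetP (proj1 (andP mM))).
    by move/(in_edge_set e_sym); rewrite e_irr.
  apply: contra vp => v'p; apply: (altwalk_partner ap end_p v'p).
  by rewrite edge_rel_sym.
move=> z w; rewrite inE => /predU1P[-> Mvw | zp Mzw _].
  by rewrite (matching_inj Mvw Mvv') eqxx.
by rewrite inE (altwalk_partner ap end_p zp Mzw) orbT.
Qed.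

(** The stem runs from the base back to [v], over [v v'] and along the other arm. The flower covers
    both arms, so the lemma also applies with the arms interchanged. *)
Lemma flower_of_blossom_arm v v' p s z t q :
    edge_rel M v' v -> uniq ((v :: p) ++ v' :: q) ->
    altp false v p -> altp false v' q ->
    v :: p = s ++ z :: t -> ~~ odd (size s) -> alt_blossom M N z t ->
    odd (size q) -> ~~ saturated M (last v' q) ->
  exists c y r, Tflower e M c y r /\
    {in (v :: p) ++ v' :: q, forall x, x \in c \/ x \in y :: r}.
Proof.
move=> Mv'v u ap aq def_p es bl oq qM.
exists (z :: t), z, (rev s ++ v' :: q); split.
  apply: (Tflower_intro e_sym e_irr mM sNe dMN) => //.
  - by have := altwalk_join Mv'v ap def_p aq; rewrite es.
  - by rewrite size_cat size_rev /= oddD (negbTE es) /= oq.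
  - apply: subcount_uniq u _ => x.
    by rewrite def_p /= ?count_cat /= ?count_cat ?count_rev /=; clear; lia.
  - by rewrite last_cat.
move=> x; rewrite def_p -catA !mem_cat => /or3P[sx | zx | qx]; last 1 [right].
- by right; rewrite inE mem_cat mem_rev sx orbT.
- by left.
- by rewrite inE mem_cat qx !orbT.
Qed.

Lemma posy_of_blossom_arms v v' p s z t q s' z' t' :
    edge_rel M v' v -> uniq ((v :: p) ++ v' :: q) ->
    altp false v p -> altp false v' q ->
    v :: p = s ++ z :: t -> ~~ odd (size s) -> alt_blossom M N z t ->
    v' :: q = s' ++ z' :: t' -> ~~ odd (size s') -> alt_blossom M N z' t' ->
  in_Tposy e M v.
Proof.
move=> Mv'v u ap aq def_p es bl def_q es' bl'.
exists (z :: t), (z' :: t'), z, (rcons (rev s ++ s') z'); split.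
  apply: (Tposy_intro e_sym e_irr mM sNe dMN) => //.
  - have := altwalk_join Mv'v ap def_p aq.
    by rewrite def_q es -cat_rcons catA -rcons_cat altwalk_cat => /andP[].
  - by rewrite size_cat size_rev oddD (negbTE es).
  apply: subcount_uniq u _ => x; rewrite def_p def_q /=.
  by rewrite !count_cat /= ?count_cat ?count_rev /=; clear; lia.
have : v \in v :: p by rewrite inE eqxx.
rewrite def_p mem_cat => /orP[sv | zv]; last by constructor 1.
by constructor 3; rewrite inE mem_rcons inE mem_cat mem_rev sv !orbT.
Qed.

Lemma flower_or_posy v : in_Tflower e M v \/ in_Tposy e M v.
Proof.
have [/saturatedP[v' Mvv'] | ] := boolP (saturated M v); last first.
  exact: flower_or_posy_unsaturated.
have Mv'v : edge_rel M v' v by rewrite edge_rel_sym.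
have [p [up ap end_p]] : exists p, [/\ uniq (v :: p), altp false v p &
    (exists s z t, [/\ v :: p = s ++ z :: t, ~~ odd (size s) &
       alt_blossom M N z t]) \/ odd (size p) && ~~ saturated M (last v p)].
  case: (@greedy [::] v) => // [p s z t up ap def_p es bl _ | p up ap op pM _].
    by exists p; split=> //; left; exists s, z, t.
  by exists p; split=> //; right; rewrite op.
(* If the arm ends in a blossom, [s] and [t] have even length, hence so has [p]. *)
have end_p' : ~~ odd (size p) || ~~ saturated M (last v p).
  case: end_p => [[s [z [t [def_p es [_ et _ _]]]]] | /andP[_ ->]]; last first.
    exact: orbT.
  move/(congr1 (odd \o size)): def_p; rewrite /= size_cat oddD /=.
  by rewrite (negbTE es) (negbTE et) => /negbRL ->.
have [v'p closed_p] := altwalk_closed Mvv' up ap end_p'.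
have vin : v \in v :: p by rewrite inE eqxx.
case: (greedy closed_p v'p) => [q s' z' t' uq aq def_q es' bl' qp
                              | q uq aq oq qM qp | q w uq aq eq Nw wp qp].
- have u := cat_uniqI up uq qp.
  case: end_p => [[s [z [t [def_p es bl]]]] | /andP[op pM]].
    by right; apply: (posy_of_blossom_arms Mv'v u ap aq def_p es bl def_q).
  have u' : uniq ((v' :: q) ++ v :: p) by rewrite uniq_catC.
  have [c [y [r [fl cov]]]] :=
    flower_of_blossom_arm Mvv' u' aq ap def_q es' bl' op pM.
  by left; exists c, y, r; split=> //; apply: cov; rewrite mem_cat vin orbT.
- have u := cat_uniqI up uq qp.
  case: end_p => [[s [z [t [def_p es bl]]]] | /andP[op pM]].
    have [c [y [r [fl cov]]]] :=
      flower_of_blossom_arm Mv'v u ap aq def_p es bl oq qM.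
    by left; exists c, y, r; split=> //; apply: cov; rewrite mem_cat vin.
  (* Both arms end in unsaturated vertices: the reversed first arm followed by the second is an
     augmenting path. *)
  case/lastP: p up ap {end_p' v'p closed_p vin qp} op pM u => // p x up ap.
  rewrite size_rcons last_rcons => ep xM u; rewrite /= in ep.
  have def_p : v :: rcons p x = (v :: p) ++ [:: x] by rewrite cats1.
  have := altwalk_join Mv'v ap def_p aq; rewrite /= negbK (negbTE ep) => ar.
  suff : saturated M (last x (rev (v :: p) ++ v' :: q)).
    by rewrite last_cat /= (negbTE qM).
  apply: no_augmenting => //.
    apply: subcount_uniq u _ => y; rewrite def_p /=.
    by rewrite !count_cat /= ?count_cat ?count_rev /=; clear; lia.
  by rewrite size_cat size_rev oddD /= oq (negbTE ep).
have u := cat_uniqI up uq qp.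
have [s [t def_p]] : exists s t, v :: p = s ++ w :: t.
  by case/splitPr: wp => s t; exists s, t.
have aw := altwalk_join Mv'v ap def_p aq.
have uw : uniq (w :: rev s ++ v' :: q).
  apply: subcount_uniq u _ => y; rewrite def_p /=.
  by rewrite !count_cat /= ?count_cat ?count_rev /=; clear; lia.
have lw : last w (rev s ++ v' :: q) = last v' q by rewrite last_cat.
(* For even [size s] the closed walk leaves [w] by an edge of [M] and returns by one of [N], an
   alternating cycle. For odd [size s] both edges are in [N], so [w] is the base of a blossom. *)
have [os | es] := boolP (odd (size s)); last first.
  suff /negP[]: ~~ edge_rel N (last w (rev s ++ v' :: q)) w by rewrite lw.
  apply: no_alt_cycle => //; last by rewrite es in aw.
  by rewrite size_cat size_rev oddD (negbTE es) /= eq.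
have blw : alt_blossom M N w (rev s ++ v' :: q).
  split=> //; rewrite ?lw //; last by rewrite os in aw.
  by rewrite size_cat size_rev oddD os /= negbK eq.
have at_ : altp true w t.
  have : altp true v' (s ++ w :: t) by rewrite -def_p /= Mv'v.
  by rewrite altwalk_cat os /= => /and3P[].
have vw : v \in w :: rev s ++ v' :: q.
  case: s def_p os {aw uw lw blw} => // x s [-> _] _.
  by rewrite inE mem_cat mem_rev inE eqxx orbT.
case: end_p => [[s1 [z [t1 [def_p1 es1 bl]]]] | /andP[op pM]]; last first.
  left; exists (w :: rev s ++ v' :: q), w, t; split; last by left.
  apply: (Tflower_intro e_sym e_irr mM sNe dMN) => //.
  - move/(congr1 (odd \o size)): def_p; rewrite /= size_cat oddD /=.
    by rewrite op os /= negbK => <-.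
  - apply: subcount_uniq u _ => y; rewrite def_p /=.
    by rewrite !count_cat /= ?count_cat ?count_rev /=; clear; lia.
  by move: pM; rewrite -[last v p]/(last v (v :: p)) def_p last_cat.
have eqst : s ++ w :: t = s1 ++ z :: t1 by rewrite -def_p.
(* Compare the positions of [w] and of the base [z] on the first arm; they differ, since [size s] is
   odd and [size s1] even. *)
have [lt_ss1 | lt_s1s | eq_ss1] := ltngtP (size s) (size s1).
- have [s2 def_s1 def_t] := eq_cat_cons eqst lt_ss1; right.
  exists (w :: rev s ++ v' :: q), (z :: t1), w, (rcons s2 z).
  split; last by constructor 1.
  apply: (Tposy_intro e_sym e_irr mM sNe dMN) => //.
  - by move: at_; rewrite def_t -cat_rcons altwalk_cat => /andP[].
  - by move: es1; rewrite def_s1 size_cat /= oddD os /= !negbK.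
  apply: subcount_uniq u _ => y; rewrite def_p def_t /=.
  by rewrite !count_cat /= ?count_cat ?count_rev /= ?count_cat /=; clear; lia.
- have [s2 def_s def_t1] := eq_cat_cons (esym eqst) lt_s1s.
  (* Traverse the blossom of the first arm from [w] to its base [z] away from
     [v], and return to [w] through [v] and [v']. *)
  have [_ et1 _ Nz] := bl.
  have ot : odd (size t).
    move: et1 os; rewrite def_t1 def_s !size_cat /= !oddD /= (negbTE es1) /=.
    by case: odd; case: odd.
  have lc : last w (t ++ z :: rev s1 ++ v' :: q) = last v' q.
    by rewrite last_cat /= last_cat.
  suff /negP[]: ~~ edge_rel N (last w (t ++ z :: rev s1 ++ v' :: q)) w.
    by rewrite lc.
  apply: no_alt_cycle.
  - apply: subcount_uniq u _ => y; rewrite def_p def_s /=.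
    by rewrite !count_cat /= ?count_cat ?count_rev /=; clear; lia.
  - rewrite !size_cat /= size_cat size_rev /= oddD ot /=.
    by rewrite oddD (negbTE es1) /= eq.
  have := altwalk_join Mv'v ap def_p1 aq; rewrite es1 => az.
  rewrite altwalk_cat at_ ot /= az andbT.
  by move: Nz; rewrite def_t1 last_cat.
by rewrite eq_ss1 (negbTE es1) in os.
Qed.

End Greedy.

Lemma pairs_altwalk (T : finType) (M N : {set {set T}}) b x p :
  altwalk M N b x p -> {subset pairs (x :: p) <= if b then M else N}.
Proof.
move: x p; fix IH 2 => x [|y [|z p]] //=.
  by rewrite andbT => xy _ /[!inE] /eqP->.
by case/and3P=> xy _; rewrite negbK => /IH sub A /[!inE] /predU1P[-> // | /sub].
Qed.

(** The pairs are exactly the edges of the walk taken from [M]; the others lie in [N], hence in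
    [F]. *)
Lemma altwalk_subpath (T : finType) (M N F : {set {set T}}) x p :
    odd (size p) -> N \subset F -> altwalk M N true x p ->
    {subset pairs (x :: p) <= F} ->
  path (edge_rel F) x p.
Proof.
move=> + /subsetP sNF; move: x p.
fix IH 2 => x [|y [|z p]] //= op.
  by rewrite !andbT /edge_rel => _ ->; rewrite ?inE.
case/and3P=> _ yz ap sF; rewrite /edge_rel sF ?inE ?eqxx //= sNF //=.
by rewrite negbK in op; apply: IH ap _ => // A pA; apply: sF; rewrite inE pA orbT.
Qed.

(** * Properties of a maximum matching with largest intersection with the factor *)

Section ExtremalMatching.
Variables (T : finType) (e : rel T) (F M : {set {set T}}).
Hypothesis odd_F : odd_cycle_factor e F.
Hypothesis max_M : maximum_matching e M.
Hypothesis max_MF : forall M', matching e M' -> #|M'| = #|M| ->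
  #|M' :&: F| <= #|M :&: F|.

Let mM : matching e M. Proof. by case: max_M. Qed.
Let sFe : F \subset edge_set e. Proof. by case: odd_F => -[]. Qed.
Let N := F :\: M.
Let sNF : N \subset F. Proof. exact: subsetDl. Qed.
Let sNe : N \subset edge_set e. Proof. exact: subset_trans sFe. Qed.

Lemma disjoint_setD : [disjoint M & N].
Proof. by apply/pred0P => A; rewrite /= inE andbA andbN. Qed.

(** Two edges of [F] meet at [x], and a matching contains at most one of them. *)
Lemma N_total x : exists y, edge_rel N x y.
Proof.
case: odd_F => -[_ /(_ x) deg2] _.
have [A] : exists A, A \in [set A in F | x \in A] :\: M.
  apply/set0Pn; rewrite setD_eq0; apply/negP => /subsetP sM.
  suff: #|[set A in F | x \in A]| <= 1 by rewrite deg2.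
  case/andP: mM => _ /trivIset_eqP tI.
  apply/card_le1_eqP => A B xA xB; have [MA MB] := (sM A xA, sM B xB).
  by move: xA xB; rewrite !inE => /andP[_ xA] /andP[_ xB]; apply: (tI B A x).
rewrite !inE => /and3P[MA FA xA].
have /imset2P[a a' _ _ defA] := subsetP sFe A FA.
move: xA MA FA; rewrite {}defA !inE => /orP[]/eqP-> MA FA; [exists a' | exists a].
  by rewrite /edge_rel inE MA.
by rewrite edge_rel_sym /edge_rel inE MA.
Qed.

Lemma no_augmenting x p :
    uniq (x :: p) -> odd (size p) -> altwalk M N false x p ->
    ~~ saturated M x -> saturated M (last x p).
Proof.
case/lastP: p => // p z u; rewrite size_rcons last_rcons /= => ep ap xM.
apply/negPn/negP => zM.
have sM : {subset pairs p <= M}.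
  case: p {u ep} ap => //= y p /andP[_]; rewrite -cats1 altwalk_cat.
  by case/andP=> /pairs_altwalk.
have tN : {subset pairs (x :: rcons p z) <= N} := pairs_altwalk ap.
(* The inner vertices pair up into the edges of [M], the whole path into those of [N], one more in
   number. *)
have [] := @exchange _ e M p (x :: rcons p z) mM _ u ep _ sM.
- by move: u; rewrite /= rcons_uniq => /and3P[].
- by rewrite /= size_rcons /= negbK.
- by move=> A /tN/(subsetP sNe).
- move=> y; rewrite inE mem_rcons inE => /or3P[/eqP-> | /eqP-> | ]; auto.
case: max_M => _ /[apply] le_M' _; rewrite /= size_rcons /= => eq_M'.
by move: le_M'; rewrite -(leq_add2r (size p)./2) eq_M' addnS ltnn.
Qed.

Lemma no_alternating_cycle x p :
    uniq (x :: p) -> odd (size p) -> altwalk M N true x p ->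
  ~~ edge_rel N (last x p) x.
Proof.
move=> u op ap; apply/negP => Nx.
have sM : {subset pairs (x :: p) <= M} := pairs_altwalk ap.
have tN : {subset pairs (rcons p x) <= N}.
  case: p {u} op ap Nx sM => //= y p ep /andP[_ ap] Nx _.
  apply: (@pairs_altwalk _ M N false).
  by rewrite -cats1 altwalk_cat ap (negbTE ep) /= Nx.
have ut : uniq (rcons p x) by rewrite rcons_uniq.
(* Rotating the cycle by one vertex turns its pairs from the edges of [M] into those of [N]. *)
have [] := @exchange _ e M (x :: p) (rcons p x) mM u ut _ _ sM.
- by rewrite /= negbK.
- by rewrite size_rcons /= negbK.
- by move=> A /tN/(subsetP sNe).
- by move=> y; rewrite mem_rcons => ->; left.
set S := [set:: pairs (x :: p)]; set S' := [set:: pairs (rcons p x)].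
move=> mM' dS' /eqP; rewrite size_rcons eqn_add2r => /eqP cM'.
have := max_MF mM' cM'.
have S'F : S' :&: F = S'.
  by apply/setIidPl/subsetP => A; rewrite inE => /tN/(subsetP sNF).
rewrite setIUl S'F -(cardsID S (M :&: F)).
have -> : (M :&: F) :&: S = S :&: F.
  rewrite setIAC [M :&: S](setIidPr _) //.
  by apply/subsetP => A; rewrite inE; apply: sM.
rewrite cardsU [_ :&: S']setIAC.
have -> : (M :\: S) :&: S' = set0 by apply/eqP; rewrite setI_eq0.
rewrite set0I cards0 subn0 setIDAC addnC leq_add2r.
rewrite !card_pairs // size_rcons -(size_pairs (x :: p)).
have -> : size (pairs (x :: p)) = #|S| by rewrite card_pairs ?size_pairs.
(* The exchange gains all of [S'] and loses only [S :&: F]. As [S] and [S'] have equal size,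
   extremality forces [S] into [F], so the whole even cycle lies in [F]. *)
move=> leSF; have /setIidPl sSF : S :&: F = S.
  by apply/eqP; rewrite eqEcard subsetIl.
have : graph_cycle (edge_rel F) (x :: p).
  apply/andP; split.
    (* A cycle on two vertices would have its single edge both in [M] and in [N]. *)
    case: p op {u sM tN ut S S' mM' dS' cM' S'F leSF sSF} ap Nx.
      by [].
    move=> y [|z p] //= _.
    rewrite andbT edge_rel_sym => Mxy.
    by rewrite /edge_rel (disjointFr disjoint_setD).
  rewrite /ucycleb u andbT /= rcons_path [edge_rel F _ _](subsetP sNF) // andbT.
  apply: altwalk_subpath ap _ => // A sA.
  by apply: (subsetP sSF); rewrite inE.
by case: odd_F => _ /[apply]; rewrite /= op.
Qed.

End ExtremalMatching.

(** Two successive maximizations: first the cardinality, then the intersection with [F] among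
    matchings of that cardinality. *)
Lemma extremal_matching (T : finType) (e : rel T) (F : {set {set T}}) :
  exists M : {set {set T}}, maximum_matching e M /\
    forall M', matching e M' -> #|M'| = #|M| -> #|M' :&: F| <= #|M :&: F|.
Proof.
have m0 : matching e set0.
  by rewrite /matching sub0set; apply/trivIset_eqP => A B x; rewrite inE.
have [M0 mM0 maxM0] := arg_maxnP (fun M : {set {set T}} => #|M|) m0.
pose P M := matching e M && (#|M| == #|M0|).
have PM0 : P M0 by rewrite /P mM0 eqxx.
have [M /andP[mM /eqP cM] maxM] :=
  arg_maxnP (fun M : {set {set T}} => #|M :&: F|) PM0.
exists M; split=> [|M' mM' cM']; first by split=> // M' /maxM0; rewrite cM.
by apply: maxM; rewrite /P mM' cM' cM eqxx.
Qed.

Theorem corollary4p13 (T : finType) (e : rel T)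
    (e_sym : symmetric e) (e_irr : irreflexive e)
    (hF : exists F : {set {set T}}, odd_cycle_factor e F) :
  Sterboul_Deming e.
Proof.
case: hF => F odd_F; have [M [maxM maxMF]] := extremal_matching e F.
have sFe : F \subset edge_set e by case: odd_F => -[].
(* The matching [M] is fixed before [v]: the same one serves for every vertex. *)
apply/setP => v; rewrite !inE; apply/negbF/asboolP; exists M; split=> //.
apply: (@flower_or_posy T e M (F :\: M)) => //; first by case: maxM.
- exact: subset_trans (subsetDl _ _) sFe.
- exact: disjoint_setD.
- exact: no_alternating_cycle odd_F maxM maxMF.
- exact: no_augmenting odd_F maxM.
- exact: N_total odd_F maxM.
Qed.
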